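(* Let $\mathcal{M}$ be an acyclic oriented matroid on a finite ground set $S$, let $(\mathcal{B},\mathcal{M})$ be an oriented building set, and let $\mathcal{F} = \mathcal{B}\cap\mathcal{L}(\mathcal{M})$ be its facial building set. Then the facial nested complex of $(\mathcal{F},\mathcal{M})$ and the acyclic nested complex of $(\mathcal{B},\mathcal{M})$ coincide.
   Context: Oriented matroids: $\mathcal{M}$ has its usual signed circuits and covectors, which are signed subsets $x=(x_+,x_-)$ of $S$ with support $\underline{x}=x_+\cup x_-$. $\mathcal{M}$ is acyclic if $(S,\varnothing)$ is a covector. A face of an acyclic $\mathcal{M}$ is a set $F\subseteq S$ such that $(S\setminus F,\varnothing)$ is a covector. The faces ordered by inclusion form the Las Vergnas face lattice $\mathcal{L}(\mathcal{M})$, with bottom $\varnothing$ and top $S$. A (boolean) building set on $S$ is a set $\mathcal{B}$ of non-empty subsets of $S$ containing all singletons and such that $B,B'\in\mathcal{B}$ with $B\cap B'\neq\varnothing$ implies $B\cup B'\in\mathcal{B}$. Let $\kappa(\mathcal{B})$ be the set of its inclusion-maximal elements. A nested set on $\mathcal{B}$ is a subset $\mathcal{N}\subseteq\mathcal{B}$ containing $\kappa(\mathcal{B})$ such that any two elements of $\mathcal{N}$ are nested or disjoint, and the union of any $k\ge2$ pairwise disjoint elements of $\mathcal{N}$ is not in $\mathcal{B}$. The pair $(\mathcal{B},\mathcal{M})$ is an oriented building set if $\underline{c}\in\mathcal{B}$ for every circuit $c$ of $\mathcal{M}$. A nested set $\mathcal{N}$ on $\mathcal{B}$ is acyclic for $\mathcal{M}$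 if $\bigcup\mathcal{N}'$ is a face of $\mathcal{M}$ for every $\mathcal{N}'\subseteq\mathcal{N}$. The acyclic nested complex of $(\mathcal{B},\mathcal{M})$ is the simplicial complex whose faces are the sets $\mathcal{N}\setminus\kappa(\mathcal{B})$ for all acyclic nested sets $\mathcal{N}$. For a finite lattice $\mathcal{L}$ with bottom $\hat 0$, an $\mathcal{L}$-building set is a subset $\mathcal{F}\subseteq\mathcal{L}_{>\hat 0}$ such that for every $Y\in\mathcal{L}_{>\hat 0}$, with $\{B_1,\dots,B_k\}=\max(\mathcal{F}_{\le Y})$, there is a poset isomorphism $\prod_{j}\mathcal{L}_{\le B_j}\to\mathcal{L}_{\le Y}$ whose $j$-th component is the inclusion. Let $\kappa(\mathcal{F})=\max(\mathcal{F})$. An $\mathcal{L}$-nested set on $\mathcal{F}$ is a subset $\mathcal{N}\subseteq\mathcal{F}$ containing $\kappa(\mathcal{F})$ such that for any $k\ge2$ pairwise incomparable $B_1,\dots,B_k\in\mathcal{N}\setminus\kappa(\mathcal{F})$, the join $B_1\vee\cdots\vee B_k$ is not in $\mathcal{F}$. The $\mathcal{L}$-nested complex of $\mathcal{F}$ is the simplicial complex with faces $\mathcal{N}\setminus\kappa(\mathcal{F})$ for all $\mathcal{L}$-nested sets $\mathcal{N}$ on $\mathcal{F}$. A facial building set is a pair $(\mathcal{F},\mathcal{M})$ where $\mathcal{F}$ is an $\mathcal{L}(\mathcal{M})$-building set (for an oriented building set $(\mathcal{B},\mathcal{M})$, the set $\mathcal{B}\cap\mathcal{L}(\mathcal{M})$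 is one), and its facial nested complex is the $\mathcal{L}(\mathcal{M})$-nested complex of $\mathcal{F}$. *)

(* Defs.v *)
From HB Require Import structures.
From mathcomp Require Import all_boot all_order.

Set Implicit Arguments.
Unset Strict Implicit.
Unset Printing Implicit Defensive.

Import Order.TTheory.

Record signed_subset (S : finType) := SignedSubset {
  signed_val :> {set S} * {set S};
  signedP : [disjoint signed_val.1 & signed_val.2]
}.
HB.instance Definition _ (S : finType) := [isSub for @signed_val S].
HB.instance Definition _ (S : finType) :=
  [Finite of signed_subset S by <:].

Section SignedSubsets.
Variable S : finType.
Implicit Types (A : {set S}) (x y : signed_subset S).

Definition pos_part x : {set S} := x.1.
Definition neg_part x : {set S} := x.2.
Definition support x : {set S} := pos_part x :|: neg_part x.

Fact opp_proof x : [disjoint neg_part x & pos_part x].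
Proof. by rewrite disjoint_sym signedP. Qed.
Definition opp x : signed_subset S :=
  @SignedSubset S (neg_part x, pos_part x) (opp_proof x).

Fact positive_proof A : [disjoint A & (set0 : {set S})].
Proof. by rewrite disjoints_subset setC0 subsetT. Qed.
Definition positive A : signed_subset S :=
  @SignedSubset S (A, set0) (positive_proof A).

Definition agree_set x y : {set S} :=
  (pos_part x :&: pos_part y) :|: (neg_part x :&: neg_part y).
Definition differ_set x y : {set S} :=
  (pos_part x :&: neg_part y) :|: (neg_part x :&: pos_part y).

Definition orthogonal x y : bool :=
  [disjoint support x & support y]
  || (agree_set x y != set0) && (differ_set x y != set0).

End SignedSubsets.

(* The signed circuit axioms; the ground set is all of S. *)
Record oriented_matroid (S : finType) := OrientedMatroid {
  circuits : {set signed_subset S};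
  circuit_neq0 : forall c, c \in circuits -> support c != set0;
  circuit_opp : forall c, c \in circuits -> opp c \in circuits;
  circuit_incomparable : forall c d, c \in circuits -> d \in circuits ->
    support c \subset support d -> c = d \/ c = opp d;
  circuit_elimination : forall c d e, c \in circuits -> d \in circuits ->
    c <> opp d -> e \in pos_part c :&: neg_part d ->
    exists2 z, z \in circuits &
      pos_part z \subset (pos_part c :|: pos_part d) :\ e
      /\ neg_part z \subset (neg_part c :|: neg_part d) :\ e
}.

Section Faces.
Variables (S : finType) (M : oriented_matroid S).
Implicit Types (A F G : {set S}).

(* The covectors are the signed subsets orthogonal to all circuits, equivalently
   the compositions of cocircuits. *)
Definition covector (x : signed_subset S) : bool :=
  [forall c in circuits M, orthogonal c x].

Definition acyclic : bool := covector (positive [set: S]).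

Definition is_face F : bool := covector (positive (~: F)).

Lemma is_faceP F :
  reflect (forall c, c \in circuits M ->
             (pos_part c \subset F) = (neg_part c \subset F))
          (is_face F).
Proof.
have orthE c : orthogonal c (positive (~: F)) =
    ((pos_part c \subset F) == (neg_part c \subset F)).
  rewrite /orthogonal /agree_set /differ_set /support /pos_part /neg_part /=.
  rewrite !setI0 !setU0 set0U disjoints_subset setCK subUset -!setDE !setD_eq0.
  by do 2!case: (_ \subset _).
apply: (iffP forall_inP) => [Fc c /Fc|Fc c /Fc Ec]; rewrite orthE.
  by move/eqP.
by rewrite Ec.
Qed.

Lemma is_faceT : is_face [set: S].
Proof. by apply/is_faceP => c _; rewrite !subsetT. Qed.

Lemma is_face0 : is_face set0 = acyclic.
Proof. by rewrite /is_face setC0. Qed.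

Lemma is_faceI F G : is_face F -> is_face G -> is_face (F :&: G).
Proof.
move=> /is_faceP faceF /is_faceP faceG; apply/is_faceP => c Cc.
by rewrite !subsetI faceF ?faceG.
Qed.

(* The smallest face containing A. *)
Definition face_closure A : {set S} :=
  \bigcap_(F : {set S} | is_face F && (A \subset F)) F.

Lemma face_closure_face A : is_face (face_closure A).
Proof.
rewrite /face_closure; elim/big_ind: _ => [|F G|F /andP[]] //.
- exact: is_faceT.
- exact: is_faceI.
Qed.

Lemma face_closure_sub A F :
  is_face F -> (face_closure A \subset F) = (A \subset F).
Proof.
move=> faceF; apply/idP/idP => [|sAF]; last first.
  by apply: bigcap_inf; rewrite faceF.
by apply: subset_trans; apply/bigcapsP => G /andP[].
Qed.

Lemma sub_face_closure A : A \subset face_closure A.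
Proof. by rewrite -face_closure_sub // face_closure_face. Qed.

Record face := Face { face_set :> {set S}; faceP : is_face face_set }.
HB.instance Definition _ := [isSub for face_set].
HB.instance Definition _ := [Finite of face by <:].

Implicit Types X Y Z : face.

Definition le_face X Y : bool := X \subset Y.

Fact le_face_refl : reflexive le_face.
Proof. by move=> X; apply: subxx. Qed.
Fact le_face_anti : antisymmetric le_face.
Proof. by move=> X Y sXYX; apply/val_inj/eqP; rewrite eqEsubset. Qed.
Fact le_face_trans : transitive le_face.
Proof. by move=> Y X Z; apply: subset_trans. Qed.

Fact face_display : Order.disp_t. Proof. exact: (Order.Disp tt tt). Qed.

HB.instance Definition _ := Order.Le_isPOrder.Build face_display face
  le_face_refl le_face_anti le_face_trans.

Definition meet_face X Y : face := Face (is_faceI (faceP X) (faceP Y)).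
Definition join_face X Y : face := Face (face_closure_face (X :|: Y)).
(* For non-acyclic M the least face need not be set0; see bot_faceE. *)
Definition bot_face : face := Face (face_closure_face set0).
Definition top_face : face := Face is_faceT.

Fact le_meet_face X Y Z :
  (X <= meet_face Y Z)%O = (X <= Y)%O && (X <= Z)%O.
Proof. exact: subsetI. Qed.
Fact le_join_face X Y Z :
  (join_face X Y <= Z)%O = (X <= Z)%O && (Y <= Z)%O.
Proof. by rewrite [LHS]face_closure_sub ?faceP // subUset. Qed.
Fact le_bot_face X : (bot_face <= X)%O.
Proof. exact: etrans (face_closure_sub _ (faceP X)) (sub0set _). Qed.
Fact le_top_face X : (X <= top_face)%O.
Proof. exact: subsetT. Qed.

HB.instance Definition _ := Order.POrder_MeetJoin_isLattice.Build
  face_display face le_meet_face le_join_face.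
HB.instance Definition _ :=
  Order.hasBottom.Build face_display face le_bot_face.
HB.instance Definition _ :=
  Order.hasTop.Build face_display face le_top_face.

Lemma le_faceE X Y : (X <= Y)%O = (face_set X \subset face_set Y).
Proof. by []. Qed.

Lemma bot_faceE : acyclic -> face_set (\bot%O : face) = set0.
Proof.
by rewrite -is_face0 => face0; apply/eqP; rewrite -subset0 face_closure_sub.
Qed.

Lemma top_faceE : face_set (\top%O : face) = [set: S].
Proof. by []. Qed.

End Faces.

Section BooleanNested.
Variable S : finType.
Implicit Types (M : oriented_matroid S) (B N : {set {set S}}).

Definition building_set B : bool :=
  [&& set0 \notin B,
      [forall s : S, [set s] \in B] &
      [forall X in B, forall Y in B,
         (X :&: Y != set0) ==> (X :|: Y \in B)]].

Definition kappa B : {set {set S}} := [set X | maxset [in B] X].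

Definition nested_set B N : bool :=
  [&& N \subset B,
      kappa B \subset N,
      [forall X in N, forall Y in N,
         [|| X \subset Y, Y \subset X | [disjoint X & Y]]] &
      [forall P : {set {set S}},
         [&& P \subset N, 1 < #|P| & trivIset P] ==> (cover P \notin B)]].

Definition oriented_building_set B M : bool :=
  building_set B && [forall c in circuits M, support c \in B].

Definition acyclic_nested_set B M N : bool :=
  nested_set B N
  && [forall P : {set {set S}}, (P \subset N) ==> is_face M (cover P)].

Definition acyclic_nested_complex B M : {set {set {set S}}} :=
  [set N :\: kappa B | N : {set {set S}} & acyclic_nested_set B M N].

End BooleanNested.

Section LatticeNested.
Variables (d : Order.disp_t) (L : finTBLatticeType d).
Implicit Types (F N A : {set L}) (x y : L).
Local Open Scope order_scope.

Definition max_elements A : {set L} :=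
  [set x in A | [forall y in A, (x <= y) ==> (y == x)]].

Definition lower_interval y := {x : L | x <= y}.

Definition max_below F y : {set L} := max_elements [set x in F | x <= y].

Definition lower_product F y :=
  {dffun forall j : {b : L | b \in max_below F y}, lower_interval (val j)}.

(* The component of phi at j is its restriction to the elements of the product
   all of whose coordinates other than the j-th are \bot. *)
Definition lattice_building_set F : Prop :=
  \bot \notin F /\
  forall y, \bot < y ->
    exists phi : lower_product F y -> lower_interval y,
      [/\ bijective phi,
          forall f g : lower_product F y,
            (forall j, val (f j) <= val (g j)) <-> val (phi f) <= val (phi g) &
          forall (f : lower_product F y) j,
            (forall k, k != j -> val (f k) = \bot) ->
            val (phi f) = val (f j)].

Definition lattice_nested_set F N : bool :=
  [&& N \subset F,
      max_elements F \subset N &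
      [forall A : {set L},
         [&& A \subset N :\: max_elements F, (1 < #|A|)%N &
             [forall x in A, forall y in A, (x != y) ==> (x >< y)]]
         ==> (\join_(x in A) x \notin F)]].

Definition lattice_nested_complex F : {set {set L}} :=
  [set N :\: max_elements F | N : {set L} & lattice_nested_set F N].

End LatticeNested.

Section Facial.
Variables (S : finType) (M : oriented_matroid S).

Definition facial_building_set (F : {set face M}) : Prop :=
  lattice_building_set F.

(* The vertices, which are faces of M, are regarded as subsets of S. *)
Definition facial_nested_complex (F : {set face M}) : {set {set {set S}}} :=
  [set [set face_set X | X in N] | N : {set face M} in lattice_nested_complex F].

Definition facial_restriction (B : {set {set S}}) : {set face M} :=
  [set X : face M | face_set X \in B].

End Facial.

Section FacialRestriction.
Variables (S : finType) (M : oriented_matroid S) (B : {set {set S}}).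
Hypotheses (acM : acyclic M) (obB : oriented_building_set B M).

Let B0 : set0 \notin B.
Proof. by case/andP: obB => /and3P[]. Qed.
Let B1 s : [set s] \in B.
Proof. by case/andP: obB => /and3P[_ /forallP]. Qed.
Let BU X Y : X \in B -> Y \in B -> X :&: Y != set0 -> X :|: Y \in B.
Proof.
case/andP: obB => /and3P[_ _ /forall_inP bU] _ BX BY nXY.
by have/forall_inP/(_ Y BY)/implyP := bU X BX; apply.
Qed.
Let BC c : c \in circuits M -> support c \in B.
Proof. by case/andP: obB => _ /forall_inP; apply. Qed.

Lemma circuit_parts c :
  c \in circuits M -> pos_part c != set0 /\ neg_part c != set0.
Proof.
move=> Cc; have := circuit_neq0 Cc; rewrite /support setU_eq0.
move: acM; rewrite -is_face0 => /is_faceP/(_ c Cc).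
by rewrite !subset0; do 2!case: (_ == _).
Qed.

Lemma face_closure_building A : A \in B -> face_closure M A \in B.
Proof.
move=> BA; pose P X := [&& X \in B, A \subset X & X \subset face_closure M A].
have PA : P A by rewrite /P BA subxx sub_face_closure.
have [X /maxsetP[/and3P[BX sAX sXA] maxX] _] := maxset_exists PA.
suff faceX : is_face M X.
  suff -> : face_closure M A = X by [].
  by apply/eqP; rewrite eqEsubset sXA face_closure_sub ?sAX.
have step c : c \in circuits M ->
    pos_part c \subset X \/ neg_part c \subset X -> support c \subset X.
  move=> Cc half; have [pc nc] := circuit_parts Cc.
  have nX : X :&: support c != set0.
    have [/set0Pn[e pe] /set0Pn[f nf]] := (pc, nc).
    apply/set0Pn; case: half => /subsetP sX.
      by exists e; rewrite !inE pe sX.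
    by exists f; rewrite !inE nf orbT sX.
  suff <- : X :|: support c = X by apply: subsetUr.
  apply: maxX; last exact: subsetUl.
  rewrite /P BU ?BC //= (subset_trans sAX) ?subsetUl //= !subUset sXA /=.
  have /is_faceP/(_ c Cc) eqc := face_closure_face M A.
  case: half => /subset_trans/(_ sXA) sc; first by rewrite -eqc sc.
  by rewrite eqc sc.
apply/is_faceP => c Cc; apply/idP/idP => sc.
  have /(step c Cc) : pos_part c \subset X \/ neg_part c \subset X by left.
  by rewrite subUset => /andP[].
have /(step c Cc) : pos_part c \subset X \/ neg_part c \subset X by right.
by rewrite subUset => /andP[].
Qed.

Lemma max_below_facialP (y b : face M) :
  reflect [/\ face_set b \in B, (b <= y)%O &
             forall x : face M,
               face_set x \in B -> (x <= y)%O -> (b <= x)%O -> x = b]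
          (b \in max_below (facial_restriction M B) y).
Proof.
rewrite !inE; apply: (iffP andP) => [[/andP[Bb by_] /forall_inP maxb]|].
  split=> // x Bx xy bx; apply/eqP.
  by have := maxb x; rewrite !inE Bx xy => /(_ isT)/implyP; apply.
case=> Bb by_ maxb; rewrite Bb by_; split=> //.
apply/forall_inP => x; rewrite !inE => /andP[Bx xy]; apply/implyP => bx.
by rewrite (maxb x).
Qed.

Lemma max_below_facial_disjoint (y b b' : face M) :
  b \in max_below (facial_restriction M B) y ->
  b' \in max_below (facial_restriction M B) y ->
  b != b' -> face_set b :&: face_set b' = set0.
Proof.
move=> /max_below_facialP[Bb by_ maxb] /max_below_facialP[Bb' b'y maxb'] neq.
apply/eqP; apply: contraNT neq => meet.
have By : face_set (b `|` b')%O \in B by apply/face_closure_building/BU.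
have uy : (b `|` b' <= y)%O by rewrite leUx by_.
by rewrite -(maxb _ By uy (leUl _ _)) {1}(maxb' _ By uy (leUr _ _)).
Qed.

Lemma max_below_facial_cover (y : face M) A :
  A \in B -> A \subset face_set y ->
  exists2 b, b \in max_below (facial_restriction M B) y & A \subset face_set b.
Proof.
move=> BA sAy; pose P := fun X : face M =>
  [&& face_set X \in B, (X <= y)%O & A \subset face_set X].
have P0 : P (Face (face_closure_face M A)).
  by rewrite /P face_closure_building // sub_face_closure andbT
     [(_ <= _)%O]face_closure_sub ?faceP.
case: (arg_maxnP (fun X : face M => #|face_set X|) P0).
move=> b /and3P[Bb by_ sAb] maxb.
exists b => //; apply/max_below_facialP; split=> // x Bx xy bx.
apply/val_inj/esym/eqP; rewrite eqEcard; apply/andP; split; first exact: bx.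
by apply: maxb; rewrite /P Bx xy (subset_trans sAb).
Qed.

Lemma facial_restriction_building :
  facial_building_set (facial_restriction M B).
Proof.
split; first by rewrite inE bot_faceE.
move=> y _; set K := max_below _ y; pose J := {b : face M | b \in K}.
pose fs (f : lower_product (facial_restriction M B) y) (j : J) :=
  face_set (val (f j)).
have fsJ f j : fs f j \subset face_set (val j) := valP (f j).
have Jy (j : J) : face_set (val j) \subset face_set y.
  by case/max_below_facialP: (valP j).
have Jeq (j k : J) s : s \in face_set (val j) -> s \in face_set (val k) ->
    j = k.
  move=> sj sk; apply/val_inj/eqP; apply: contraT => neq.
  have := max_below_facial_disjoint (valP j) (valP k) neq.
  by move/setP/(_ s); rewrite !inE sj sk.
have inU f (j : J) s : s \in face_set (val j) ->
    (s \in \bigcup_k fs f k) = (s \in fs f j).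
  move=> sj; apply/bigcupP/idP => [[k _ sk]|]; last by exists j.
  by rewrite (Jeq j k s) // (subsetP (fsJ f k)).
have Uy f : \bigcup_j fs f j \subset face_set y.
  by apply/bigcupsP => j _; apply: subset_trans (fsJ f j) (Jy j).
have faceU f : is_face M (\bigcup_j fs f j).
  have half c (P Q : {set S}) : support c = P :|: Q ->
      c \in circuits M ->
      (forall F, is_face M F -> P \subset F -> Q \subset F) ->
      P \subset \bigcup_j fs f j -> Q \subset \bigcup_j fs f j.
    move=> cE Cc PQ sP; have sQ := PQ _ (faceP y) (subset_trans sP (Uy f)).
    have [|b Kb] := max_below_facial_cover (y := y) (BC Cc).
      by rewrite cE subUset sQ (subset_trans sP).
    rewrite cE subUset => /andP[sPb sQb]; pose j : J := exist _ b Kb.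
    have sPj : P \subset fs f j.
      apply/subsetP => s Ps; rewrite -(inU f j) ?(subsetP sP) //.
      exact: (subsetP sPb).
    by apply: subset_trans (PQ _ (faceP _) sPj) (bigcup_sup j _).
  apply/is_faceP => c Cc; apply/idP/idP.
    by apply: (half c) => // F /is_faceP/(_ c Cc) ->.
  by apply: (half c); rewrite 1?setUC // => F /is_faceP/(_ c Cc) ->.
pose phi f : lower_interval y :=
  exist (fun x : face M => (x <= y)%O) (Face (faceU f)) (Uy f).
have psiP (x : lower_interval y) (j : J) : (val x `&` val j <= val j)%O.
  exact: leIr.
pose psi (x : lower_interval y) : lower_product (facial_restriction M B) y :=
  [ffun j => exist (fun x : face M => (x <= val j)%O) _ (psiP x j)].
have le_phi (f g : lower_product (facial_restriction M B) y) :
    (forall j, (val (f j) <= val (g j))%O) <->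
    (val (phi f) <= val (phi g))%O.
  split=> [le_fg | /subsetP le_fg j].
    apply/bigcupsP => j _; apply: subset_trans (le_fg j) _.
    exact: (bigcup_sup j).
  apply/subsetP => s sj.
  have sJ : s \in face_set (val j) by apply: (subsetP (fsJ f j)).
  by have := le_fg s; rewrite /= !(inU _ j) //; apply.
exists phi; split=> //; last first.
  move=> f j f0; apply/val_inj => /=; apply/eqP; rewrite eqEsubset.
  rewrite (bigcup_sup j) // andbT; apply/bigcupsP => k _.
  have [-> //|/f0 fk0] := eqVneq k j.
  by rewrite /fs fk0 bot_faceE // sub0set.
exists psi => [f|x].
  apply/ffunP => j; rewrite ffunE; apply/val_inj/val_inj/setP => s /=.
  rewrite inE; have [sj|nsj] := boolP (s \in face_set (val j)).
    by rewrite andbT (inU f j).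
  by rewrite andbF; apply/esym/negbTE; apply: contra nsj; apply/subsetP/fsJ.
apply/val_inj/val_inj/setP => s /=; apply/bigcupP/idP => [[j _]|sx].
  by rewrite /fs ffunE inE => /andP[].
have sy : [set s] \subset face_set y.
  by rewrite sub1set (subsetP (valP x)).
have [b Kb] := max_below_facial_cover (B1 s) sy; rewrite sub1set => sb.
exists (exist _ b Kb : J) => //.
by rewrite /fs ffunE inE sx.
Qed.

End FacialRestriction.

(* Main.v *)
Require Import Defs.
From mathcomp Require Import all_boot all_order.

(** Both complexes turn out to have the same nested sets: a set [N] of faces is
    lattice-nested on the facial building set exactly when, read as a family of
    subsets of [S], it is nested on [B] and acyclic ([acyclic_nested_facial]);
    conversely every member of an acyclic nested set is a face, as the union of
    a one-element subfamily.  Since a member of [B] has its face closure in [B],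
    maximal members of [B] are faces, so the two notions also remove the same
    maximal elements ([kappa_facial]).

    In one direction, two or more pairwise incomparable members of an acyclic
    nested set are disjoint and their union is a face, so that their join in
    the face lattice is their union, which is not in [B].

    In the other direction everything follows from the fact that an antichain
    of at least two members of [N] has its join outside [B]
    ([nested_join_notin]).  Were two incomparable members to meet, or were the
    union of two or more disjoint members to belong to [B], the closure of this
    union would be such a join inside [B].  If the union [U] of a subfamily [P]
    of [N] were not a face, some circuit [c] would have one of its two parts,
    but not the other, inside [U].  The maximal members of [P] that meet the
    first part cover it, so that their join contains the support of [c]; gluing
    these members along the support, which is in [B], shows that their join is
    in [B].  Hence there is only one such member; being a face that contains
    one part of [c] it contains the other, a contradiction. *)

Set Implicit Arguments.
Unset Strict Implicit.
Unset Printing Implicit Defensive.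

Import Order.TTheory.

(** The definition of nested sets restricts this to antichains avoiding the
    maximal elements; a maximal element of [F] in the antichain would have to
    equal the join, hence to lie above all the other members. *)
Lemma nested_join_notin (d : Order.disp_t) (L : finTBLatticeType d)
    (F N A : {set L}) :
  lattice_nested_set F N -> A \subset N -> 1 < #|A| ->
  {in A &, forall x y, (x <= y)%O -> x = y} ->
  (\join_(x in A) x)%O \notin F.
Proof.
move=> /and3P[_ _ /forallP nestN] sAN A1 antiA.
have [/existsP[x /andP[Ax]]|noMax] :=
  boolP [exists x in A, x \in max_elements F].
  rewrite inE => /andP[_ /forall_inP maxx]; apply/negP => FJ.
  have leJ y : y \in A -> (y <= \join_(x in A) x)%O := @joins_sup _ _ _ y _ id.
  have /implyP/(_ (leJ x Ax))/eqP Jx := maxx _ FJ.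
  have /subset_leq_card : A \subset [set x].
    apply/subsetP => y Ay; rewrite inE; apply/eqP/antiA => //.
    by rewrite -Jx leJ.
  by rewrite cards1 leqNgt A1.
apply: (implyP (nestN A)); rewrite A1 /=; apply/andP; split.
  apply/subsetP => x Ax; rewrite in_setD (subsetP sAN) // andbT.
  by apply: contra noMax => maxx; apply/existsP; exists x; rewrite Ax.
apply/forall_inP => x Ax; apply/forall_inP => y Ay; apply/implyP => neq.
rewrite /Order.comparable negb_or; apply/andP; split; apply: contra neq.
  by move/(antiA x y Ax Ay) => ->.
by move/(antiA y x Ay Ax) => ->.
Qed.

Lemma building_setU (S : finType) (B : {set {set S}}) (X Y : {set S}) :
  building_set B -> X \in B -> Y \in B -> X :&: Y != set0 -> X :|: Y \in B.
Proof.
move=> /and3P[_ _ /forall_inP bU] BX BY nXY.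
by have/forall_inP/(_ Y BY)/implyP := bU X BX; apply.
Qed.

(** The members of [Q] need not meet one another: [Z] glues them together. *)
Lemma building_setU_cover (S : finType) (B Q : {set {set S}}) (Z : {set S}) :
  building_set B -> Z \in B -> Q \subset B ->
  {in Q, forall X, X :&: Z != set0} -> cover Q :|: Z \in B.
Proof.
move=> bB BZ /subsetP sQB meetQ; rewrite /cover.
elim/big_rec: _ => [|X U QX BU]; first by rewrite set0U.
rewrite -setUA; apply: building_setU => //; first exact: sQB.
have /set0Pn[e /setIP[Xe Ze]] := meetQ X QX.
by apply/set0Pn; exists e; rewrite !inE Xe Ze orbT.
Qed.

Lemma face_joinE (S : finType) (M : oriented_matroid S) (A : {set face M}) :
  face_set (\join_(X in A) X)%O = face_closure M (cover (@face_set S M @: A)).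
Proof.
set C := cover _; apply/eqP; rewrite eqEsubset; apply/andP; split.
  have : (\join_(X in A) X <= Face (face_closure_face M C))%O.
    apply/joinsP => X AX; rewrite le_faceE.
    apply: subset_trans (sub_face_closure M C).
    by apply: (bigcup_sup (face_set X)) => //; apply: imset_f.
  by rewrite le_faceE.
rewrite face_closure_sub ?faceP //; apply/bigcupsP => _ /imsetP[X AX ->].
by rewrite -le_faceE joins_sup.
Qed.

Section FacialNested.
Variables (S : finType) (M : oriented_matroid S) (B : {set {set S}}).
Hypotheses (acM : acyclic M) (obB : oriented_building_set B M).
Implicit Types (N : {set face M}).

Let F := facial_restriction M B.
Let fs := @face_set S M.

Let bB : building_set B. Proof. by case/andP: obB. Qed.
Let injfs : injective fs. Proof. exact: val_inj. Qed.

Lemma building_sub_facial (X : {set S}) :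
  X \in B -> exists2 Y : face M, Y \in F & X \subset fs Y.
Proof.
move=> BX; exists (Face (face_closure_face M X)).
  by rewrite inE; apply: face_closure_building.
exact: sub_face_closure.
Qed.

(** The face closure of a maximal member of [B] is again in [B], so that a
    maximal member is its own closure. *)
Lemma kappa_facial : kappa B = fs @: max_elements F.
Proof.
apply/setP => X; rewrite inE; apply/maxsetP/imsetP.
  move=> [BX maxX]; have [Y FY sXY] := building_sub_facial BX.
  have YX : fs Y = X by apply: maxX => //; rewrite inE in FY.
  exists Y; rewrite // inE FY; apply/forall_inP => Z; rewrite inE => BZ.
  apply/implyP; rewrite le_faceE => sYZ; apply/eqP/injfs.
  by rewrite YX; apply: maxX; rewrite // -YX.
move=> [Y]; rewrite inE => /andP[FY /forall_inP maxY] ->.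
split=> [|Z BZ sYZ]; first by rewrite inE in FY.
have [W FW sZW] := building_sub_facial BZ.
have /implyP := maxY W FW; rewrite le_faceE (subset_trans sYZ) //.
move=> /(_ isT)/eqP WY; apply/eqP.
by rewrite eqEsubset sYZ andbT -WY.
Qed.

Lemma nested_closure_notin N (Q : {set {set S}}) :
  lattice_nested_set F N -> Q \subset fs @: N -> 1 < #|Q| ->
  {in Q &, forall X Y : {set S}, X \subset Y -> X = Y} ->
  face_closure M (cover Q) \notin B.
Proof.
move=> nestN sQN Q1 antiQ; pose A := [set X in N | fs X \in Q].
have QA : Q = fs @: A.
  apply/setP => X; apply/idP/imsetP => [QX|[Y]]; last first.
    by rewrite inE => /andP[_ QY] ->.
  have /imsetP[Y NY XY] := subsetP sQN X QX.
  by exists Y; rewrite // inE NY -XY.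
have : (\join_(x in A) x)%O \notin F.
  apply: (nested_join_notin nestN _ _ _).
  - by apply/subsetP => X; rewrite inE => /andP[].
  - by rewrite -(card_imset _ injfs) -QA.
  move=> X Y; rewrite !inE => /andP[_ QX] /andP[_ QY]; rewrite le_faceE.
  by move=> sXY; apply/injfs/antiQ.
by rewrite inE face_joinE -QA.
Qed.

Lemma sub_building N : lattice_nested_set F N -> fs @: N \subset B.
Proof.
case/and3P=> /subsetP sNF _ _; apply/subsetP => _ /imsetP[X NX ->].
by have := sNF X NX; rewrite inE.
Qed.

Lemma nested_cover_face N (P : {set {set S}}) :
  lattice_nested_set F N -> P \subset fs @: N -> is_face M (cover P).
Proof.
move=> nestN sPN.
(* The two parts of a circuit play symmetric roles. *)
have half c (C D : {set S}) : c \in circuits M -> Defs.support c = C :|: D ->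
    C != set0 -> (forall G, is_face M G -> C \subset G -> D \subset G) ->
    C \subset cover P -> D \subset cover P.
  move=> Cc cE /set0Pn[e0 Ce0] CD sCP.
  (* Maximality makes [Q] an antichain; meeting [C] lets [c] glue it. *)
  pose Q := [set X | maxset [in P] X & X :&: C != set0].
  have sQP X : X \in Q -> X \in P by rewrite inE => /andP[/maxsetP[]].
  have sQN : Q \subset fs @: N.
    by apply/subsetP => X /sQP; apply/subsetP.
  have CQ : C \subset cover Q.
    apply/subsetP => e Ce; have /bigcupP[X PX Xe] := subsetP sCP e Ce.
    have [Y maxY sXY] := maxset_exists (P := [in P]) PX.
    apply/bigcupP; exists Y; last exact: subsetP Xe.
    rewrite inE maxY; apply/set0Pn; exists e.
    by rewrite inE Ce (subsetP sXY).
  have BQc : face_closure M (cover Q) \in B.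
    have Bc : Defs.support c \in B by case/andP: obB => _ /forall_inP; apply.
    have sQB : Q \subset B := subset_trans sQN (sub_building nestN).
    have BQ : cover Q :|: Defs.support c \in B.
      apply: building_setU_cover => // X.
      rewrite inE => /andP[_ /set0Pn[e /setIP[Xe Ce]]].
      by apply/set0Pn; exists e; rewrite inE cE !inE Xe Ce.
    (* A face containing [C] contains all of the support of [c]. *)
    suff <- : face_closure M (cover Q :|: Defs.support c) =
        face_closure M (cover Q).
      exact: face_closure_building.
    have faceQ := face_closure_face M (cover Q).
    have CQc := subset_trans CQ (sub_face_closure M (cover Q)).
    apply/eqP; rewrite eqEsubset !face_closure_sub ?face_closure_face //.
    rewrite subUset sub_face_closure cE subUset CQc CD //=.
    exact: subset_trans (subsetUl _ _) (sub_face_closure _ _).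
  have Q1 : #|Q| <= 1.
    rewrite leqNgt; apply: contraL BQc => Q1.
    apply: (nested_closure_notin nestN sQN Q1 _) => X Y.
    rewrite !inE => /andP[/maxsetP[_ maxX] _] /andP[/maxsetP[PY _] _] sXY.
    by rewrite (maxX Y).
  have /bigcupP[X QX _] := subsetP CQ e0 Ce0.
  have QE : Q = [set X].
    by apply/esym/eqP; rewrite eqEcard sub1set QX cards1.
  have faceX : is_face M X.
    by have /imsetP[Y _ ->] := subsetP sQN X QX; apply: faceP.
  move: CQ; rewrite QE cover1 => /(CD X faceX) sDX.
  exact: subset_trans sDX (bigcup_sup X (sQP X QX)).
apply/is_faceP => c Cc; have [pc nc] := circuit_parts acM Cc.
have cE : Defs.support c = neg_part c :|: pos_part c by rewrite setUC.
apply/idP/idP; [apply: (half c) => // | apply: (half c) => //] => G.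
  by move=> /is_faceP/(_ c Cc) ->.
by move=> /is_faceP/(_ c Cc) ->.
Qed.

Lemma nested_facial N :
  lattice_nested_set F N -> nested_set B (fs @: N).
Proof.
move=> nestN; have sNB := sub_building nestN.
apply/and4P; split=> //.
- by rewrite kappa_facial imsetS //; case/and3P: nestN.
- apply/forall_inP => X NX; apply/forall_inP => Y NY.
  rewrite -setI_eq0 orbA; apply: contraT; rewrite !negb_or.
  move=> /andP[/andP[nXY nYX] meet].
  have BX := subsetP sNB X NX; have BY := subsetP sNB Y NY.
  have neq : X != Y by apply: contraNneq nXY => ->.
  have cE : cover [set X; Y] = X :|: Y by rewrite /cover bigcup_setU !big_set1.
  have : face_closure M (cover [set X; Y]) \notin B.
    apply: (nested_closure_notin nestN _ _ _).
    + by rewrite subUset !sub1set NX.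
    + by rewrite cards2 neq.
    move=> U V /set2P[]-> /set2P[]-> //; first by rewrite (negPf nXY).
    by rewrite (negPf nYX).
  by rewrite cE (face_closure_building acM obB) ?building_setU.
apply/forallP => P; apply/implyP => /and3P[sPN P1 /trivIsetP trivP].
apply/negP => BP; have : face_closure M (cover P) \notin B.
  apply: (nested_closure_notin nestN sPN P1 _) => X Y PX PY sXY.
  apply/eqP/contraT => /(trivP X Y PX PY).
  rewrite -setI_eq0 (setIidPl sXY) => /eqP X0.
  have := subsetP (subset_trans sPN sNB) X PX.
  by rewrite X0; case/and3P: bB => /negPf->.
by rewrite (face_closure_building acM obB).
Qed.

Lemma facial_nested N :
  acyclic_nested_set B M (fs @: N) -> lattice_nested_set F N.
Proof.
move=> /andP[/and4P[/subsetP sNB skN /forall_inP nestN /forallP disjN]].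
move=> /forallP acN; apply/and3P; split.
- by apply/subsetP => X NX; rewrite inE sNB // imset_f.
- apply/subsetP => X FX; have : fs X \in fs @: N.
    by apply: (subsetP skN); rewrite kappa_facial imset_f.
  by rewrite mem_imset.
apply/forallP => A; apply/implyP => /and3P[sAN A1 /forall_inP antiA].
have {}sAN : A \subset N := subset_trans sAN (subsetDl _ _).
have sfAN : fs @: A \subset fs @: N by apply: imsetS.
have faceA : is_face M (cover (fs @: A)) by apply: (implyP (acN _)).
have closedA : face_closure M (cover (fs @: A)) = cover (fs @: A).
  by apply/eqP; rewrite eqEsubset sub_face_closure face_closure_sub // subxx.
rewrite inE face_joinE closedA; apply: (implyP (disjN _)).
rewrite sfAN card_imset // A1; apply/trivIsetP.
move=> _ _ /imsetP[X AX ->] /imsetP[Y AY ->] neq.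
have {}neq : X != Y by apply: contraNneq neq => ->.
have /forall_inP/(_ Y AY)/implyP/(_ neq) := antiA X AX.
rewrite /Order.comparable !le_faceE negb_or => /andP[/negPf nXY /negPf nYX].
have NX := subsetP sfAN _ (imset_f fs AX).
have NY := subsetP sfAN _ (imset_f fs AY).
by have /forall_inP/(_ _ NY) := nestN _ NX; rewrite nXY nYX.
Qed.

Lemma acyclic_nested_facial N :
  acyclic_nested_set B M (fs @: N) = lattice_nested_set F N.
Proof.
apply/idP/idP => [|nestN]; first exact: facial_nested.
rewrite /acyclic_nested_set nested_facial //=.
by apply/forallP => P; apply/implyP; apply: nested_cover_face.
Qed.

(** One-element subfamilies show that all members of [N] are faces. *)
Lemma acyclic_nested_faces (N : {set {set S}}) :
  acyclic_nested_set B M N -> N = fs @: [set X | fs X \in N].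
Proof.
move=> /andP[_ /forallP acN]; apply/setP => X; apply/idP/imsetP => [NX|[Y]].
  have /implyP := acN [set X]; rewrite sub1set cover1 => /(_ NX) faceX.
  by exists (Face faceX); rewrite ?inE.
by rewrite inE => NY ->.
Qed.

Lemma imset_setD_kappa N :
  fs @: (N :\: max_elements F) = (fs @: N) :\: kappa B.
Proof.
rewrite kappa_facial; apply/setP => X; rewrite inE.
apply/imsetP/andP => [[Y]|[nX /imsetP[Y NY XY]]].
  by rewrite inE => /andP[nY NY] ->; rewrite !mem_imset.
by exists Y; rewrite // inE NY andbT; move: nX; rewrite XY mem_imset.
Qed.

End FacialNested.

Theorem theorem6p3 (S : finType) (M : oriented_matroid S) (B : {set {set S}}) :
  acyclic M -> oriented_building_set B M ->
  facial_nested_complex (facial_restriction M B) = acyclic_nested_complex B M.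
Proof.
move=> acM obB; apply/setP => D; apply/imsetP/imsetP.
  move=> [_ /imsetP[N nestN ->] ->].
  exists (@face_set S M @: N); last exact: imset_setD_kappa.
  by move: nestN; rewrite !inE acyclic_nested_facial.
move=> [N]; rewrite inE => nestN ->.
have NE := acyclic_nested_faces nestN.
rewrite NE -imset_setD_kappa //; eexists; last by [].
by apply: imset_f; rewrite inE -acyclic_nested_facial // -NE.
Qed.
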